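(* Let $n$ and $m$ be positive integers and let $\varepsilon\in\{1,-1\}$. Then the polynomial $$\frac{1}{n}\sum_{k=0}^{n-1}\varepsilon^k(2k+1)\,d_k(x)^m\, s_k(x)^m$$ in $x$ is integer-valued.
   Context: For a non-negative integer $n$, define the polynomials $d_n(x)=\sum_{k=0}^n \binom{n}{k}\binom{x}{k}2^k$ and $s_n(x)=\sum_{k=0}^n \binom{n}{k}\binom{x}{k}\binom{x+k}{k}$, where for a non-negative integer $k$ the generalized binomial coefficient is $\binom{y}{k}=y(y-1)\cdots(y-k+1)/k!$ (with $\binom{y}{0}=1$). A polynomial $P(x)$ with real coefficients is called integer-valued if $P(x)\in\mathbb{Z}$ for all $x\in\mathbb{Z}$. *)

(* Defs.v *)
From mathcomp Require Import all_boot all_order all_algebra.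
From mathcomp Require Import reals.

Set Implicit Arguments.
Unset Strict Implicit.
Unset Printing Implicit Defensive.

Import Order.TTheory GRing.Theory Num.Theory.
Local Open Scope ring_scope.

(* The generalized binomial coefficient y (y - 1) ... (y - k + 1) / k!, where
   the upper argument y is itself a polynomial; y = 'X and y = 'X + k occur. *)
Definition gbinom (R : realType) (y : {poly R}) (k : nat) : {poly R} :=
  (k`!%:R : R)^-1 *: \prod_(i < k) (y - i%:R).

Definition d_poly (R : realType) (n : nat) : {poly R} :=
  \sum_(k < n.+1) 'C(n, k)%:R * gbinom 'X k * 2 ^+ k.

Definition s_poly (R : realType) (n : nat) : {poly R} :=
  \sum_(k < n.+1) 'C(n, k)%:R * gbinom 'X k * gbinom ('X + k%:R) k.

Definition integer_valued (R : realType) (P : {poly R}) : Prop :=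
  forall x : R, x \is a Num.int -> P.[x] \is a Num.int.

(* Main.v *)
Require Import Defs.
From mathcomp Require Import all_boot all_order all_algebra.
From mathcomp Require Import reals.
From mathcomp Require Import zify ring.

(** Fix a natural number x and write L_j(n) for the product of the binomials
    (n choose j) and (n + j choose j); these are the coefficients of the n-th
    shifted Legendre polynomial.  As functions of n, both d_n(x) and s_n(x)
    have the parity (-1)^x under n |-> -1 - n, so their product is a rational
    combination of the L_j.  The point is that the coefficients are integers:

      d_n(x) s_n(x) = sum over k, j of
        (-1)^j 2^k (x+k choose k) (k+j choose k) (x+k choose 2(k+j)) L_{k+j}(n)

    which is [delannoy_mul_sun].  Neither factor has this property alone: the
    coefficient of L_2 in d_n(4) is 8/3.

    The functions of n in the integer span of the L_j form a ring, because
    L_i L_j is an explicit integer combination of the L_{j+l}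
    ([legendre_coef_mul]); hence the m-th power of the product stays in this
    span.  It remains to sum the basis: with weight 2k+1, and with or without
    an alternating sign, the sum of L_j(k) over k < n telescopes to an integer
    multiple of n ([sum_legendre_coef], [alternating_sum_legendre_coef]).
    The negative integers x reduce to the natural ones: replacing x by -1 - x
    fixes s_k and multiplies d_k by (-1)^k, which only changes the sign eps to
    eps (-1)^m.

    The expansion of d_n(x) s_n(x) is obtained as follows.  Set
    G_a(n) = sum over j of (n choose j)(x choose j)(1+a)^j, whose coefficient
    of a^r is (n choose r)(n+x-r choose n).  Then d_n(x) is G_1, and s_n(x)
    comes from G_a on replacing a^r by (x choose r).  There is a product formula

      G_a(n) G_b(n) = sum over i of (-ab)^i (n choose i)(n+x-i choose n)
            * sum over k of (n-i choose k)(x-i choose k)((1+a)(1+b))^k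

    proved coefficient by coefficient in [bin_prod_coef]: the sum over k is a
    Vandermonde convolution and the sum over i a finite difference of binomial
    coefficients.  Specializing b to 1 and a^r to (x choose r) gives
    [delannoy_sun_alternating].  Its i-sum is not yet visibly invariant under
    n |-> -1 - n; splitting (x choose i) by Vandermonde
    ([alternating_term_split]) brings out the factor L_{k+j}(n), and what is
    left of the i-sum is again a finite difference, with a value independent
    of n. *)

Set Implicit Arguments.
Unset Strict Implicit.
Unset Printing Implicit Defensive.

Import Order.TTheory GRing.Theory Num.Theory.
Local Open Scope ring_scope.

(** * Sums and binomial coefficients *)

Lemma sum_trunc (V : nmodType) (F : nat -> V) (N M : nat) :
  (forall i, (N <= i)%N -> F i = 0) -> (N <= M)%N ->
  \sum_(i < M) F i = \sum_(i < N) F i.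
Proof.
move=> F0 leNM; rewrite -!(big_mkord xpredT F) (big_cat_nat (leq0n N) leNM) //=.
rewrite [X in _ + X]big_nat [X in _ + X]big1 ?addr0 // => i /andP[leNi _]; exact: F0.
Qed.

Lemma sum_shift (V : nmodType) (F : nat -> V) (j N : nat) :
  (j <= N)%N ->
  \sum_(i < N) (if (j <= i)%N then F (i - j)%N else 0) = \sum_(i < N - j) F i.
Proof.
move=> lejN; rewrite -(big_mkord xpredT (fun i => if (j <= i)%N then F (i - j)%N else 0)).
rewrite (big_cat_nat (leq0n j) lejN) //= [X in X + _]big_nat [X in X + _]big1 ?add0r; last first.
  by move=> i /andP[_ ltij]; rewrite leqNgt ltij.
rewrite -{1}(add0n j) big_addn big_mkord; apply: eq_bigr => i _.
by rewrite leq_addl addnK.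
Qed.

Section Bin.
Local Open Scope nat_scope.

Lemma mul_bin_trinomial (a b c : nat) :
  'C(a + b + c, a) * 'C(b + c, b) = 'C(a + b + c, a + b) * 'C(a + b, a).
Proof.
have fpos := fact_gt0.
apply/eqP; rewrite -(eqn_pmul2r (fpos a)) -(eqn_pmul2r (fpos b)) -(eqn_pmul2r (fpos c)).
have e1 := @bin_fact (a+b+c) a ltac:(lia).
have e2 := @bin_fact (b+c) b ltac:(lia).
have e3 := @bin_fact (a+b+c) (a+b) ltac:(lia).
have e4 := @bin_fact (a+b) a ltac:(lia).
have -> : 'C(a + b + c, a) * 'C(b + c, b) * a`! * b`! * c`! = (a+b+c)`!.
  rewrite -e1 (_ : a+b+c-a = b+c); last by lia.
  by rewrite -e2 (_ : b+c-b = c); [ring|lia].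
have -> : 'C(a + b + c, a + b) * 'C(a + b, a) * a`! * b`! * c`! = (a+b+c)`!.
  rewrite -e3 (_ : a+b+c-(a+b) = c); last by lia.
  by rewrite -e4 (_ : a+b-a = b); [ring|lia].
exact: eqxx.
Qed.

(** Both sides count the chains of a k-subset in an m-subset of an n-set.  For
    k <= m the identity survives truncated subtraction even when m > n. *)
Lemma bin_subset (n m k : nat) : k <= m -> 'C(n, m) * 'C(m, k) = 'C(n, k) * 'C(n - k, m - k).
Proof.
move=> lekm; have [lemn|ltnm] := leqP m n; last first.
  rewrite bin_small // mul0n; have [lekn|ltnk] := leqP k n.
    by rewrite [X in _ * X]bin_small ?muln0 //; lia.
  by rewrite bin_small.
have := mul_bin_trinomial k (m - k) (n - m).
rewrite (_ : k + (m - k) + (n - m) = n); last by lia.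
rewrite (_ : m - k + (n - m) = n - k); last by lia.
by rewrite (_ : k + (m - k) = m); [|lia].
Qed.

Lemma bin_disjoint (n a b : nat) : 'C(n, a) * 'C(n - a, b) = 'C(n, a + b) * 'C(a + b, a).
Proof. by rewrite bin_subset ?leq_addr // addKn. Qed.

Lemma bin_disjointC (n a b : nat) : 'C(n, a) * 'C(n - a, b) = 'C(n, b) * 'C(n - b, a).
Proof.
by rewrite !bin_disjoint [in RHS]addnC -(bin_sub (leq_addr b a)) addKn.
Qed.

Lemma bin_subset_compl (n m k : nat) :
  m <= n -> 'C(n, m) * 'C(m, k) = 'C(n, k) * 'C(n - k, n - m).
Proof.
move=> lemn; rewrite bin_disjointC bin_sub // subKn //.
Qed.

(** Vandermonde convolution after the reflection j |-> a - j.  Only shifts of the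
    lower index by addition occur, so no side condition relates b, e and a. *)
Lemma Vandermonde_shift (a b e N : nat) : a < N ->
  \sum_(j < N) 'C(a, j) * 'C(b, e + j) = 'C(a + b, a + e).
Proof.
move=> ltaN.
rewrite -(binomial.Vandermonde a b).
rewrite (@sum_trunc _ (fun j => 'C(a, j) * 'C(b, a + e - j)) a.+1); last 2 first.
- by move=> i lti; rewrite bin_small.
- by lia.
rewrite (@sum_trunc _ (fun j => 'C(a, j) * 'C(b, e + j)) a.+1) //; last first.
  by move=> i lti; rewrite bin_small.
rewrite (reindex_inj rev_ord_inj) /=; apply: eq_bigr => j _.
have ltj := ltn_ord j; rewrite subSS bin_sub; last by lia.
by congr (_ * 'C(_, _)); lia.
Qed.

End Bin.

(** The r-th backward difference of y |-> (y choose r + p) at r + m is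
    (m choose p).  The summation range may stop early at N as soon as one of the
    two binomial factors vanishes from there on. *)
Lemma alternating_bin (r m p N : nat) : (r < N)%N || (m < N + p)%N ->
  \sum_(i < N) (-1) ^+ i * ('C(r, i) * 'C(r + m - i, r + p))%:R = 'C(m, p)%:R :> int.
Proof.
have zr M i : (r.+1 <= i)%N ->
  (-1) ^+ i * ('C(r, i) * 'C(r + m - i, r + M))%:R = 0 :> int.
  by move=> lti; rewrite bin_small // mul0n mulr0.
move=> hN.
pose F i : int := (-1) ^+ i * ('C(r, i) * 'C(r + m - i, r + p))%:R.
transitivity (\sum_(i < r.+1) F i).
  case/orP: hN => hN; first by apply: (sum_trunc (F := F)) => // i; exact: zr.
  rewrite -(@sum_trunc _ F r.+1 (N + r.+1)) ?leq_addl //; last by move=> i; exact: zr.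
  rewrite (@sum_trunc _ F N) ?leq_addr // => i leNi.
  have [ler|ltr] := leqP i r; last exact: zr.
  by rewrite /F [X in (_ * X)%N]bin_small ?muln0 ?mulr0 //; lia.
rewrite {}/F {hN zr N}.
elim: r m p => [|r IHr] m p.
  by rewrite big_ord_recl big_ord0 /= addr0 !add0n bin0 mul1n expr0 mul1r subn0.
rewrite big_ord_recl /= bin0 mul1n expr0 mul1r subn0.
under eq_bigr => i _.
  rewrite /bump /= add1n binS mulnDl natrD mulrDr exprS mulN1r !mulNr.
  over.
rewrite /= big_split /= addrA.
have -> : \sum_(i < r.+1) - ((-1) ^+ i * ('C(r, i) * 'C(r.+1 + m - i.+1, r.+1 + p))%:R)
          = - 'C(m, p.+1)%:R :> int.
  rewrite sumrN -IHr; congr (- _); apply: eq_bigr => i _.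
  by rewrite addSn subSS addSn addnS.
suff -> : 'C(r.+1 + m, r.+1 + p)%:R +
    \sum_(i < r.+1) - ((-1) ^+ i * ('C(r, i.+1) * 'C(r.+1 + m - i.+1, r.+1 + p))%:R)
    = 'C(m.+1, p.+1)%:R :> int.
  by rewrite binS natrD addrAC subrr add0r.
rewrite -IHr big_ord_recr [in RHS]big_ord_recl /= (@bin_small r r.+1) // mul0n mulr0 oppr0 addr0.
rewrite expr0 mul1r bin0 mul1n subn0 addSn !addnS addSn; congr (_ + _).
apply: eq_bigr => i _; rewrite /bump /= add1n exprS mulN1r mulNr.
by rewrite subSS.
Qed.

(** * Two polynomial sequences at a natural argument *)

Definition delannoy (n x : nat) : nat :=
  (\sum_(k < n.+1) 'C(n, k) * 'C(x, k) * 2 ^ k)%N.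

Definition sun_number (n x : nat) : nat :=
  (\sum_(k < n.+1) 'C(n, k) * 'C(x, k) * 'C(x + k, k))%N.

Definition legendre_coef (j n : nat) : nat := ('C(n, j) * 'C(n + j, j))%N.

Section Expansions.
Local Open Scope nat_scope.

(** The coefficient of a^r in the sum over k of
    (n choose k)(x choose k)(1+a)^k. *)
Lemma bin_prod_expand (n x r : nat) : r <= x ->
  'C(n, r) * 'C(n + x - r, n) = \sum_(k < n.+1) 'C(n, k) * 'C(x, k) * 'C(k, r).
Proof.
move=> lerx.
under eq_bigr => k _.
  rewrite mulnAC bin_subset_compl; last by rewrite -ltnS.
  rewrite -mulnA (mulnC 'C(n - r, _)).
  over.
rewrite -big_distrr /= binomial.Vandermonde.
have [lern|ltnr] := leqP r n; last by rewrite bin_small.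
by congr (_ * 'C(_, _)); lia.
Qed.

Lemma sum_bin (k N : nat) : k < N -> \sum_(r < N) 'C(k, r) = 2 ^ k.
Proof.
move=> ltkN; rewrite -(addn1 1) expnDn.
rewrite (@sum_trunc _ (fun r => 'C(k, r)) k.+1) //; last first.
  by move=> i lti; rewrite bin_small.
by apply: eq_bigr => i _; rewrite !exp1n !muln1.
Qed.

Lemma delannoyE (n x : nat) :
  delannoy n x = \sum_(q < x.+1) 'C(n, q) * 'C(n + x - q, n).
Proof.
under eq_bigr => q _ do rewrite bin_prod_expand ?leq_ord //.
rewrite exchange_big /=; apply: eq_bigr => k _; rewrite -big_distrr /=.
have [lekx|ltxk] := leqP k x; first by rewrite sum_bin.
by rewrite (@bin_small x k) // muln0 !mul0n.
Qed.

Lemma sun_numberE (n x : nat) :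
  sun_number n x = \sum_(r < x.+1) 'C(x, r) * ('C(n, r) * 'C(n + x - r, n)).
Proof.
under eq_bigr => r _.
  rewrite bin_prod_expand ?leq_ord // big_distrr /=.
  over.
rewrite exchange_big /=; apply: eq_bigr => k _.
under eq_bigr => r _ do rewrite mulnCA.
rewrite -big_distrr /=; congr (_ * _).
rewrite -[LHS]bin_sub ?leq_addl // addnK.
by have := @Vandermonde_shift x k 0 x.+1 (ltnSn x); rewrite addn0 => <-.
Qed.

(** The coefficient of a^r in a^i (1+a)^k. *)
Definition shifted_bin (k i r : nat) : nat := if i <= r then 'C(k, r - i) else 0.

Lemma sum_bin4 (a b r q : nat) : r <= b ->
  \sum_(k < b.+1) 'C(a, k) * 'C(b, k) * ('C(k, r) * 'C(k, q))
  = 'C(a, r) * 'C(b, q) * 'C(a - r + (b - q), b - r).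
Proof.
move=> lerb.
pose H j := 'C(a, r) * 'C(b, q) * ('C(a - r, j) * 'C(b - q, b - r - j)).
transitivity (\sum_(k < b.+1) (if r <= k then H (k - r) else 0)).
  apply: eq_bigr => k _; have lekb : k <= b by rewrite -ltnS.
  case: leqP => [lerk|ltkr]; last by rewrite (@bin_small k r) // muln0.
  rewrite /H mulnACA bin_subset // bin_subset_compl // (_ : b - r - (k - r) = b - k); last by lia.
  exact: mulnACA.
rewrite (sum_shift H); last by lia.
by rewrite subSn // /H -big_distrr /= binomial.Vandermonde.
Qed.

Lemma sum_shifted_bin2 (a b i r q : nat) : i <= r -> i <= q -> r <= b ->
  \sum_(k < b.+1) 'C(a - i, k) * 'C(b - i, k) * (shifted_bin k i r * shifted_bin k i q)
  = 'C(a - i, r - i) * 'C(b - i, q - i) * 'C(a - i - (r - i) + (b - i - (q - i)), b - r).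
Proof.
move=> leir leiq lerb; rewrite /shifted_bin leir leiq.
pose F k := 'C(a - i, k) * 'C(b - i, k) * ('C(k, r - i) * 'C(k, q - i)).
rewrite (@sum_trunc _ F (b - i).+1); first last.
- by rewrite ltnS leq_subr.
- by move=> k ltk; rewrite /F (@bin_small (b - i) k) // muln0.
rewrite sum_bin4; last by lia.
by congr (_ * 'C(_, _)); lia.
Qed.

(** The inner sum is a Vandermonde convolution; rearranging its value isolates
    the only factors that depend on i, namely those of a finite difference of
    order r. *)
Lemma coef_term (n x r q i : nat) : r <= x -> q <= x -> i <= x ->
  'C(n, i) * 'C(n + x - i, n) * (\sum_(k < x.+1)
     'C(n - i, k) * 'C(x - i, k) * (shifted_bin k i r * shifted_bin k i q))
  = 'C(n, r) * 'C(n + x - q, n) * 'C(n + x - r - q, x - r)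
    * ('C(r, i) * 'C(n + x - i, n + x - q)).
Proof.
move=> lerx leqx leix.
have [leir|ltri] := leqP i r; last first.
  rewrite [in RHS](@bin_small r i) // mul0n muln0 big1 ?muln0 // => k _.
  by rewrite /shifted_bin leqNgt ltri /= mul0n muln0.
have [leiq|ltqi] := leqP i q; last first.
  rewrite [in RHS](@bin_small (n + x - i)) ?muln0; last by lia.
  rewrite big1 ?muln0 // => k _.
  by rewrite /shifted_bin [i <= q]leqNgt ltqi /= !muln0.
rewrite sum_shifted_bin2 //.
have e1 : 'C(n, r) * 'C(r, i) = 'C(n, i) * 'C(n - i, r - i) by rewrite bin_subset.
have e2 : 'C(n + x - i, n) * 'C(x - i, q - i) = 'C(n + x - q, n) * 'C(n + x - i, n + x - q).
  rewrite [RHS]mulnC bin_subset; last by lia.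
  rewrite -[in LHS](@bin_sub (x - i)); last by lia.
  by congr (_ * 'C(_, _)); lia.
have [lern|ltnr] := leqP r n; last first.
  by move: e1; rewrite (@bin_small n r) // !mul0n mulnACA (mulnA 'C(n, i)) => <-; rewrite !mul0n.
have -> : n - i - (r - i) + (x - i - (q - i)) = n + x - r - q by lia.
transitivity (('C(n, i) * 'C(n - i, r - i)) * ('C(n + x - i, n) * 'C(x - i, q - i))
   * 'C(n + x - r - q, x - r)); first by ring.
by rewrite -e1 e2; ring.
Qed.

End Expansions.

(** The coefficient of a^r b^q in the product formula for G_a(n) G_b(n). *)
Lemma bin_prod_coef (n x r q : nat) : (r <= x)%N -> (q <= x)%N ->
  ('C(n, r) * 'C(n + x - r, n) * ('C(n, q) * 'C(n + x - q, n)))%:R =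
  \sum_(i < x.+1) (-1) ^+ i * ('C(n, i) * 'C(n + x - i, n) * (\sum_(k < x.+1)
     'C(n - i, k) * 'C(x - i, k) * (shifted_bin k i r * shifted_bin k i q)))%N%:R :> int.
Proof.
move=> lerx leqx.
under eq_bigr => i _.
  rewrite coef_term ?leq_ord // natrM mulrCA.
  over.
rewrite -mulr_sumr /=.
have [lern|ltnr] := leqP r n; last by rewrite (@bin_small n r) // !mul0n mul0r.
have -> : \sum_(i < x.+1) (-1) ^+ i * ('C(r, i) * 'C(n + x - i, n + x - q))%N%:R
   = 'C(n + x - r, n + x - q - r)%:R :> int.
  rewrite -(@alternating_bin r _ _ x.+1) ?ltnS ?lerx //.
  by apply: eq_bigr => i _; congr (_ * (_ * 'C(_, _))%N%:R); lia.
rewrite -natrM; congr (_%:R).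
have -> : 'C(n + x - r, n + x - q - r) = 'C(n + x - r, q).
  by rewrite -[RHS]bin_sub; [congr 'C(_, _)|]; lia.
transitivity ('C(n, r) * 'C(n + x - q, n) * ('C(n + x - r, q) * 'C(n + x - r - q, x - r)))%N; last by ring.
rewrite bin_disjointC -(@bin_sub _ (x - r)); last by lia.
by rewrite (_ : n + x - r - (x - r) = n)%N; [ring|lia].
Qed.

Lemma sum_shifted_bin (k i x : nat) : (k + i <= x)%N ->
  (\sum_(r < x.+1) shifted_bin k i r = 2 ^ k)%N.
Proof.
move=> le.
rewrite (sum_shift (fun r => 'C(k, r))); last by lia.
by rewrite sum_bin //; lia.
Qed.

Lemma sum_bin_shifted_bin (k i x : nat) : (k + i <= x)%N ->
  (\sum_(r < x.+1) 'C(x, r) * shifted_bin k i r = 'C(x + k, k + i))%N.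
Proof.
move=> le; rewrite addnC -(@Vandermonde_shift k x i (x.+1 - i)); last by lia.
rewrite -(sum_shift (fun j => 'C(k, j) * 'C(x, i + j))%N); last by lia.
apply: eq_bigr => r _; rewrite /shifted_bin; case: leqP => [leir|_]; last by rewrite muln0.
by rewrite subnKC // mulnC.
Qed.

(** The product formula with b = 1 and a^r replaced by (x choose r): the powers
    (1+b)^k become 2^k, and a^i (1+a)^k becomes (x+k choose k+i). *)
Lemma delannoy_sun_alternating (n x : nat) :
  (delannoy n x * sun_number n x)%:R = \sum_(i < x.+1) \sum_(k < x.+1)
    (-1) ^+ i * ('C(n, i) * 'C(n + x - i, n) * ('C(n - i, k) * 'C(x - i, k))
                 * (2 ^ k * 'C(x + k, k + i)))%:R :> int.
Proof.
rewrite mulnC sun_numberE delannoyE big_distrl /= natr_sum.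
under eq_bigr => r _.
  rewrite big_distrr /= natr_sum.
  under eq_bigr => q _.
    rewrite -mulnA natrM bin_prod_coef ?leq_ord // mulr_sumr.
    over.
  rewrite exchange_big /=.
  over.
rewrite exchange_big /=; apply: eq_bigr => i _.
transitivity ((-1) ^+ i * (\sum_(r < x.+1) \sum_(q < x.+1) \sum_(k < x.+1)
   'C(n, i) * 'C(n + x - i, n) * ('C(n - i, k) * 'C(x - i, k))
   * ('C(x, r) * shifted_bin k i r * shifted_bin k i q))%N%:R : int).
  rewrite natr_sum mulr_sumr; apply: eq_bigr => r _.
  rewrite natr_sum mulr_sumr; apply: eq_bigr => q _.
  rewrite mulrCA -natrM; congr (_ * _%:R).
  rewrite !big_distrr /=; apply: eq_bigr => k _; ring.
rewrite -mulr_sumr -natr_sum; congr (_ * _%:R).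
under [LHS]eq_bigr => r _ do rewrite exchange_big /=.
rewrite exchange_big /=; apply: eq_bigr => k _.
under [LHS]eq_bigr => r _ do rewrite -big_distrr /= -big_distrr /=.
rewrite -big_distrr /= -big_distrl /=.
have [le|lt] := leqP (k + i) x.
  by rewrite sum_shifted_bin // sum_bin_shifted_bin // mulnC [in RHS]mulnC; congr (_ * _); rewrite mulnC.
by rewrite (@bin_small (x - i) k) ?muln0 ?mul0n //; have := ltn_ord i; lia.
Qed.

(** * The product in the shifted Legendre basis *)

(** Rearranging factorials turns (x+k choose k+i) into (x choose i), which is then
    split by Vandermonde over j.  Each piece contains the factor
    [legendre_coef (k + j) n] and depends on i only through two binomials of
    the shape required by [alternating_bin]. *)
Lemma alternating_term_split (n x i k : nat) : (i <= x)%N ->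
  ('C(n, i) * 'C(n + x - i, n) * ('C(n - i, k) * 'C(x - i, k)) * 'C(x + k, k + i)
  = \sum_(j < x.+1) 'C(x + k, k) * 'C(k + j, k) * legendre_coef (k + j) n *
     (if j <= i then 'C(n - (k + j), i - j) * 'C(n + x - i, n + (k + j)) else 0))%N.
Proof.
move=> leix; have [le|lt] := leqP (k + i) x; last first.
  rewrite (@bin_small (x - i) k) ?muln0 ?mul0n; last by lia.
  rewrite big1 // => j _; case: leqP => [leji|_]; last by rewrite muln0.
  by rewrite (@bin_small (n + x - i)) ?muln0 //; lia.
transitivity ('C(x + k, k) * ('C(n, k + i) * 'C(n + x - i, n) * 'C(x - i, k)) * 'C(x, i))%N.
  have e1 : ('C(n, i) * 'C(n - i, k) = 'C(n, k + i) * 'C(k + i, k))%N.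
    by rewrite bin_disjointC bin_disjoint.
  have e2 : ('C(x + k, k + i) * 'C(k + i, k) = 'C(x + k, k) * 'C(x, i))%N.
    by rewrite bin_subset ?leq_addr // addnK addKn.
  transitivity (('C(n, i) * 'C(n - i, k)) * ('C(n + x - i, n) * 'C(x - i, k) * 'C(x + k, k + i)))%N.
    ring.
  rewrite e1.
  transitivity (('C(x + k, k + i) * 'C(k + i, k)) * ('C(n, k + i) * 'C(n + x - i, n) * 'C(x - i, k)))%N.
    ring.
  by rewrite e2; ring.
have -> : 'C(x, i) = (\sum_(j < x.+1) 'C(x - i - k, j) * 'C(k + i, k + j))%N.
  rewrite Vandermonde_shift; last by lia.
  by rewrite -(bin_sub leix); congr 'C(_, _); lia.
rewrite big_distrr /=; apply: eq_bigr => j _.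
case: leqP => [leji|ltij]; last first.
  by rewrite (@bin_small (k + i)) ?muln0 //; lia.
have e1 : ('C(n, k + j) * 'C(n - (k + j), i - j) = 'C(n, k + i) * 'C(k + i, k + j))%N.
  by rewrite bin_disjoint (_ : k + j + (i - j) = k + i)%N; last by lia.
have e2 : ('C(n + x - i, n + (k + j)) * 'C(n + (k + j), n) = 'C(n + x - i, n) * 'C(x - i, k + j))%N.
  rewrite bin_subset ?leq_addr // addKn; congr (_ * 'C(_, _))%N; lia.
have e3 : ('C(x - i, k + j) * 'C(k + j, k) = 'C(x - i, k) * 'C(x - i - k, j))%N.
  by rewrite bin_subset ?leq_addr // addKn.
have e4 : 'C(n + (k + j), k + j) = 'C(n + (k + j), n).
  by rewrite -[LHS]bin_sub ?leq_addl // addnK.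
rewrite /legendre_coef e4.
transitivity ('C(x + k, k) * ('C(n, k + i) * 'C(k + i, k + j)) * 'C(n + x - i, n)
  * ('C(x - i, k) * 'C(x - i - k, j)))%N; first by ring.
rewrite -e1 -e3.
transitivity ('C(x + k, k) * ('C(n, k + j) * 'C(n - (k + j), i - j)) * 'C(k + j, k)
  * ('C(n + x - i, n) * 'C(x - i, k + j)))%N; first by ring.
by rewrite -e2; ring.
Qed.

(** The coefficient vanishes when k + 2j > x, so the range of j is harmless; it
    does not depend on n, because the order of the difference taken in i is
    n - (k + j) while its base point is n + x - j. *)
Lemma delannoy_mul_sun (n x : nat) :
  (delannoy n x * sun_number n x)%:R = \sum_(k < x.+1) \sum_(j < x.+1)
    (-1) ^+ j * (2 ^ k * 'C(x + k, k) * 'C(k + j, k) * 'C(x + k, 2 * (k + j)))%:R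
    * (legendre_coef (k + j) n)%:R :> int.
Proof.
rewrite delannoy_sun_alternating exchange_big /=; apply: eq_bigr => k _.
transitivity (\sum_(i < x.+1) \sum_(j < x.+1)
   (2 ^ k * 'C(x + k, k) * 'C(k + j, k))%:R * (legendre_coef (k + j) n)%:R *
   (if (j <= i)%N then (-1) ^+ i * ('C(n - (k + j), i - j)
       * 'C(n + x - i, n + (k + j)))%:R else 0) : int).
  apply: eq_bigr => i _.
  rewrite (mulnCA _ (2 ^ k)%N) alternating_term_split ?leq_ord // natrM natr_sum !mulr_sumr.
  apply: eq_bigr => j _; case: leqP => _; last by rewrite muln0 !mulr0.
  by rewrite !natrM; ring.
rewrite exchange_big /=; apply: eq_bigr => j _; rewrite -mulr_sumr.
have [leKn|ltnK] := leqP (k + j) n; last first.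
  by rewrite /legendre_coef (@bin_small n) // mul0n !mulr0 mul0r.
pose r := (n - (k + j))%N.
pose F i : int := (-1) ^+ j * ((-1) ^+ i * ('C(r, i) * 'C(r + (x + k) - i, r + 2 * (k + j)))%:R).
transitivity ((2 ^ k * 'C(x + k, k) * 'C(k + j, k))%:R * (legendre_coef (k + j) n)%:R
   * \sum_(i < x.+1) (if (j <= i)%N then F (i - j)%N else 0)).
  congr (_ * _); apply: eq_bigr => i _; case: leqP => // leji.
  rewrite /F mulrA -exprD subnKC //; congr (_ * (_ * 'C(_, _))%N%:R); rewrite /r; lia.
have lejx := leq_ord j.
rewrite (sum_shift F) ?leqW // /F -mulr_sumr alternating_bin; last by lia.
by rewrite !natrM; ring.
Qed.

(** * The ring spanned by the shifted Legendre coefficients *)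

(** This is a form of the Pfaff-Saalschutz identity, obtained from three
    Vandermonde convolutions: [legendre_coef (j + l) n] is expanded over m, the
    sum over l is carried out first, then the sum over m.  The hypothesis
    i <= j keeps j + l - i free of truncation. *)
Lemma legendre_coef_mul (i j n : nat) : (i <= j)%N ->
  (legendre_coef i n * legendre_coef j n = \sum_(l < i.+1)
     'C(i + j, i) * 'C(j + l, i) * 'C(i, l) * legendre_coef (j + l) n)%N.
Proof.
move=> leij; have [lein|ltni] := leqP i n; last first.
  rewrite {1}/legendre_coef (@bin_small n i) // !mul0n big1 // => l _.
  by rewrite /legendre_coef (@bin_small n (j + l)) ?muln0 //; lia.
transitivity ('C(i + j, i) * 'C(n, i) * (\sum_(l < i.+1) \sum_(m < i.+1)
    'C(i, m) * 'C(n + j, j + m)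
    * (if m <= l then 'C(i - m, l - m) * 'C(n - i, j + l - i) else 0)))%N; last first.
  rewrite big_distrr /=; apply: eq_bigr => l _.
  have -> : legendre_coef (j + l) n = ('C(n, j + l) * \sum_(m < i.+1) 'C(l, m) * 'C(n + j, j + m))%N.
    rewrite Vandermonde_shift // /legendre_coef; congr (_ * 'C(_, _))%N; lia.
  have e1 : ('C(n, j + l) * 'C(j + l, i) = 'C(n, i) * 'C(n - i, j + l - i))%N.
    by rewrite bin_subset //; lia.
  transitivity ('C(i + j, i) * ('C(n, j + l) * 'C(j + l, i)) *
     ('C(i, l) * \sum_(m < i.+1) 'C(l, m) * 'C(n + j, j + m)))%N; last by ring.
  rewrite e1 !big_distrr /=; apply: eq_bigr => m _.
  case: leqP => [leml|ltlm]; last by rewrite (@bin_small l m) // ?mul0n ?muln0.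
  transitivity ('C(i + j, i) * 'C(n, i) * 'C(n - i, j + l - i) * ('C(i, m) * 'C(i - m, l - m))
     * 'C(n + j, j + m))%N; first by ring.
  by rewrite -bin_subset //; ring.
rewrite exchange_big /=.
have -> : (\sum_(m < i.+1) \sum_(l < i.+1) 'C(i, m) * 'C(n + j, j + m)
    * (if m <= l then 'C(i - m, l - m) * 'C(n - i, j + l - i) else 0)
  = 'C(n + j, j) * \sum_(m < i.+1) 'C(i, m) * 'C(n, j + m))%N.
  rewrite big_distrr /=; apply: eq_bigr => m _; rewrite -big_distrr /=.
  have lemi := leq_ord m.
  pose F l := ('C(i - m, l) * 'C(n - i, j + m - i + l))%N.
  have -> : (\sum_(l < i.+1) (if m <= l then 'C(i - m, l - m) * 'C(n - i, j + l - i) else 0)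
      = \sum_(l < i.+1) (if m <= l then F (l - m) else 0))%N.
    apply: eq_bigr => l _; case: leqP => // leml; congr (_ * 'C(_, _))%N; lia.
  rewrite (sum_shift F) ?leqW // /F Vandermonde_shift; last by lia.
  have -> : 'C(i - m + (n - i), i - m + (j + m - i)) = 'C(n - m, j) by congr 'C(_, _); lia.
  have := bin_disjointC (n + j) j (j + m); rewrite addnK (_ : n + j - (j + m) = n - m)%N; last by lia.
  by move=> e; rewrite -mulnA -e; ring.
rewrite Vandermonde_shift //.
have e : ('C(i + n, i + j) * 'C(i + j, i) = 'C(n + i, i) * 'C(n, j))%N.
  by rewrite bin_subset ?leq_addr // !addKn addnC.
transitivity ('C(n, i) * 'C(n + j, j) * ('C(i + n, i + j) * 'C(i + j, i)))%N; last by ring.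
by rewrite e /legendre_coef; ring.
Qed.

(** The coefficients are listed as pairs (coefficient, index), in any order and
    with repetitions, so that addition of functions is concatenation. *)
Definition legendre_span (f : nat -> int) : Prop :=
  exists s : seq (int * nat), forall n, f n = \sum_(p <- s) p.1 * (legendre_coef p.2 n)%:R.

Lemma legendre_span_ext (f g : nat -> int) : f =1 g -> legendre_span g -> legendre_span f.
Proof. by move=> efg [s gE]; exists s => n; rewrite efg. Qed.

Lemma legendre_span_basis (c : int) (j : nat) : legendre_span (fun n => c * (legendre_coef j n)%:R).
Proof. by exists [:: (c, j)] => n; rewrite big_seq1. Qed.

Lemma legendre_span_add (f g : nat -> int) :
  legendre_span f -> legendre_span g -> legendre_span (fun n => f n + g n).
Proof. by move=> [s fE] [t gE]; exists (s ++ t) => n; rewrite big_cat fE gE. Qed.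

Lemma legendre_span_sum (I : Type) (r : seq I) (F : I -> nat -> int) :
  (forall i, legendre_span (F i)) -> legendre_span (fun n => \sum_(i <- r) F i n).
Proof.
move=> FS; elim: r => [|i r IHr].
  by exists [::] => n; rewrite !big_nil.
by apply: legendre_span_ext (legendre_span_add (FS i) IHr) => n; rewrite big_cons.
Qed.

Lemma legendre_span_mul_basis (c : int) (i j : nat) :
  legendre_span (fun n => c * ((legendre_coef i n)%:R * (legendre_coef j n)%:R)).
Proof.
wlog leij : i j / (i <= j)%N => [hw|].
  have [leij|/ltnW leji] := leqP i j; first exact: hw.
  by apply: legendre_span_ext (hw j i leji) => n; rewrite (mulrC (legendre_coef i n)%:R).
apply: (@legendre_span_ext _ (fun n => \sum_(l < i.+1)
   (c * ('C(i + j, i) * 'C(j + l, i) * 'C(i, l))%:R) * (legendre_coef (j + l) n)%:R)).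
  move=> n; rewrite -natrM legendre_coef_mul // natr_sum mulr_sumr.
  by apply: eq_bigr => l _; rewrite natrM mulrA.
by apply: legendre_span_sum => l; exact: legendre_span_basis.
Qed.

Lemma legendre_span_mul (f g : nat -> int) :
  legendre_span f -> legendre_span g -> legendre_span (fun n => f n * g n).
Proof.
move=> [s fE] [t gE].
apply: (@legendre_span_ext _ (fun n => \sum_(p <- s) \sum_(q <- t)
   (p.1 * q.1) * ((legendre_coef p.2 n)%:R * (legendre_coef q.2 n)%:R))).
  move=> n; rewrite fE gE mulr_suml; apply: eq_bigr => p _.
  by rewrite mulr_sumr; apply: eq_bigr => q _; exact: mulrACA.
do 2![apply: legendre_span_sum => ?]; exact: legendre_span_mul_basis.
Qed.

Lemma legendre_span_exp (f : nat -> int) (m : nat) :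
  legendre_span f -> legendre_span (fun n => f n ^+ m).
Proof.
move=> fS; elim: m => [|m IHm].
  apply: legendre_span_ext (legendre_span_basis 1 0) => n.
  by rewrite expr0 /legendre_coef !bin0 mulr1.
by apply: legendre_span_ext (legendre_span_mul fS IHm) => n; rewrite exprS.
Qed.

Lemma delannoy_mul_sun_span (x : nat) :
  legendre_span (fun n => (delannoy n x * sun_number n x)%:R).
Proof.
apply: legendre_span_ext (fun n => delannoy_mul_sun n x) _.
do 2![apply: legendre_span_sum => ?]; exact: legendre_span_basis.
Qed.

(** * Weighted sums of the basis *)

Lemma succ_mul_bin_add (n j : nat) :
  (n.+1 * 'C(n.+1 + j, j) = (n.+1 + j) * 'C(n + j, j))%N.
Proof. by have := mul_bin_down (n.+1 + j) j; rewrite addnK addSn. Qed.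

Lemma sum_legendre_coef (j n : nat) :
  (\sum_(k < n) (2 * k + 1) * legendre_coef j k = n * ('C(n, j.+1) * 'C(n + j, j)))%N.
Proof.
elim: n => [|n IHn]; first by rewrite big_ord0.
rewrite big_ord_recr /= IHn /legendre_coef.
transitivity ('C(n.+1, j.+1) * (n.+1 * 'C(n.+1 + j, j)))%N; last by ring.
rewrite succ_mul_bin_add binS.
suff e : (n * 'C(n, j.+1) + (2 * n + 1) * 'C(n, j) = ('C(n, j.+1) + 'C(n, j)) * (n.+1 + j))%N.
  transitivity ((n * 'C(n, j.+1) + (2 * n + 1) * 'C(n, j)) * 'C(n + j, j))%N; first by ring.
  by rewrite e; ring.
have [lejn|ltnj] := leqP j n; last by rewrite !bin_small //; lia.
have := mul_bin_left n j; nia.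
Qed.

Lemma alternating_sum_legendre_coef (j n : nat) :
  \sum_(k < n.+1) (-1) ^+ k * ((2 * k + 1) * legendre_coef j k)%:R
  = n.+1%:R * ((-1) ^+ n * ('C(n, j) * 'C(n.+1 + j, j))%:R) :> int.
Proof.
elim: n => [|n IHn].
  rewrite big_ord_recl big_ord0 /legendre_coef /= addr0 !mul1r.
  by case: j => [|j]; rewrite ?bin0.
rewrite big_ord_recr /= {}IHn /legendre_coef mulrCA [RHS]mulrCA -!natrM.
rewrite [in LHS]exprS [in RHS]exprS !mulN1r !mulNr; apply/eqP; rewrite subr_eq eq_sym addrC -mulrBr; apply/eqP.
congr (_ * _); apply/eqP; rewrite subr_eq -natrD eqr_nat; apply/eqP.
(* Everything reduces to 2n + 3 = (n + j + 2) + (n + 1 - j). *)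
have e1 := succ_mul_bin_add n.+1 j.
have e2 := mul_bin_down n.+1 j; rewrite /= in e2.
transitivity ('C(n.+1, j) * ((2 * n.+1 + 1) * 'C(n.+1 + j, j)))%N; first by ring.
transitivity ('C(n.+1, j) * (n.+2 * 'C(n.+2 + j, j)) + (n.+1 * 'C(n, j)) * 'C(n.+1 + j, j))%N; last by ring.
rewrite e1 e2.
have [lejn|ltnj] := leqP j n.+1; last by rewrite (@bin_small n.+1 j) // !mul0n muln0 mul0n.
set a := 'C(_, _); set b := 'C(_, _).
have -> : (2 * n.+1 + 1 = n.+2 + j + (n.+1 - j))%N by lia.
ring.
Qed.

(** It suffices to treat the basis, where the two closed forms exhibit the
    factor n. *)
Lemma dvd_sum_legendre_span (f : nat -> int) (e : int) (n : nat) :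
  legendre_span f -> e = 1 \/ e = -1 ->
  exists z : int, \sum_(k < n) e ^+ k * (2 * k + 1)%:R * f k = n%:R * z.
Proof.
move=> [s fE] he.
have basis j : exists z : int,
    \sum_(k < n) e ^+ k * (2 * k + 1)%:R * (legendre_coef j k)%:R = n%:R * z.
  case: he => ->.
    exists ('C(n, j.+1) * 'C(n + j, j))%:R; rewrite -natrM -sum_legendre_coef natr_sum.
    by apply: eq_bigr => k _; rewrite expr1n mul1r natrM.
  case: n => [|n]; first by exists 0; rewrite big_ord0 mulr0.
  exists ((-1) ^+ n * ('C(n, j) * 'C(n.+1 + j, j))%:R).
  by rewrite -alternating_sum_legendre_coef; apply: eq_bigr => k _; rewrite natrM mulrA.
suff [z zE] : exists z : int, \sum_(p <- s) p.1 *
    \sum_(k < n) e ^+ k * (2 * k + 1)%:R * (legendre_coef p.2 k)%:R = n%:R * z.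
  exists z; rewrite -zE.
  under eq_bigr => k _ do rewrite fE mulr_sumr.
  rewrite exchange_big /=; apply: eq_bigr => p _; rewrite mulr_sumr.
  by apply: eq_bigr => k _; rewrite mulrCA.
elim: s {fE} => [|p s [z IHs]]; first by exists 0; rewrite big_nil mulr0.
have [w wE] := basis p.2; exists (p.1 * w + z).
by rewrite big_cons IHs wE mulrDr mulrCA.
Qed.

(** * Evaluation at integers *)

Lemma horner_natr (R : comNzRingType) (c : nat) (y : R) : (c%:R : {poly R}).[y] = c%:R.
Proof. by rewrite -[c%:R]/(1 *+ c) hornerMn hornerC. Qed.

Lemma prodr_falling (R : pzRingType) (m k : nat) :
  \prod_(i < k) (m%:R - i%:R) = (m ^_ k)%:R :> R.
Proof.
elim: k => [|k IHk]; first by rewrite big_ord0 ffactn0.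
rewrite big_ord_recr /= IHk ffactnSr natrM.
have [lekm|ltmk] := leqP k m; first by rewrite natrB.
by rewrite ffact_small // !mul0r.
Qed.

Lemma horner_gbinom (R : realType) (Q : {poly R}) (k m : nat) (y : R) :
  Q.[y] = m%:R -> (gbinom Q k).[y] = 'C(m, k)%:R.
Proof.
move=> Qy; rewrite /gbinom hornerZ horner_prod.
under eq_bigr => i _ do rewrite hornerD hornerN horner_natr Qy.
rewrite prodr_falling -bin_ffact natrM mulrC mulfK //.
by rewrite pnatr_eq0 -lt0n fact_gt0.
Qed.

(** Reversing the product of the k factors exchanges the upper argument z with
    k - 1 - z up to the sign (-1)^k.  With Q = 'X and Q = 'X + k this covers
    both binomials of [s_poly] at -1 - x. *)
Lemma horner_gbinom_reflect (R : realType) (Q : {poly R}) (k m : nat) (y : R) :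
  Q.[y] = k%:R - 1 - m%:R -> (gbinom Q k).[y] = (-1) ^+ k * 'C(m, k)%:R.
Proof.
move=> Qy; rewrite -(@horner_gbinom R m%:R k m y) ?horner_natr //.
rewrite /gbinom !hornerZ !horner_prod mulrCA; congr (_ * _).
rewrite (reindex_inj rev_ord_inj) /= -[X in (-1) ^+ X]card_ord -prodrN.
apply: eq_bigr => i _; rewrite !hornerD !hornerN !horner_natr Qy natrB //.
by rewrite -natr1; ring.
Qed.

Lemma horner_d_poly_nat (R : realType) (n x : nat) :
  (d_poly R n).[x%:R] = (delannoy n x)%:R.
Proof.
rewrite /d_poly /delannoy horner_sum natr_sum; apply: eq_bigr => k _.
rewrite !hornerM horner_exp !horner_natr (@horner_gbinom _ _ _ x) ?hornerX //.
by rewrite !natrM natrX.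
Qed.

Lemma horner_s_poly_nat (R : realType) (n x : nat) :
  (s_poly R n).[x%:R] = (sun_number n x)%:R.
Proof.
rewrite /s_poly /sun_number horner_sum natr_sum; apply: eq_bigr => k _.
rewrite !hornerM !horner_natr (@horner_gbinom _ _ _ x) ?hornerX //.
by rewrite (@horner_gbinom _ _ _ (x + k)) ?hornerD ?hornerX ?horner_natr ?natrD // !natrM.
Qed.

(** At -1 - x the binomials (x choose k) and (x+k choose k) are exchanged, each
    with a sign (-1)^k, so every summand is unchanged. *)
Lemma horner_s_poly_reflect (R : realType) (n x : nat) :
  (s_poly R n).[- 1 - x%:R] = (sun_number n x)%:R.
Proof.
rewrite /s_poly /sun_number horner_sum natr_sum; apply: eq_bigr => k _.
rewrite !hornerM !horner_natr (@horner_gbinom_reflect _ _ _ (x + k)); last first.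
  by rewrite hornerX natrD; ring.
rewrite (@horner_gbinom_reflect _ _ _ x); last first.
  by rewrite hornerD hornerX horner_natr; ring.
rewrite mulrA -[_ * _ * (-1) ^+ k]mulrA [_ * (-1) ^+ k]mulrAC -expr2 sqrr_sign mul1r.
by rewrite !natrM mulrAC.
Qed.

Lemma sum_bin_bin_exp (R : comNzRingType) (c : R) (n r : nat) :
  \sum_(k < n.+1) ('C(n, k) * 'C(k, r))%:R * c ^+ k
  = 'C(n, r)%:R * (c ^+ r * (1 + c) ^+ (n - r)).
Proof.
have [lern|ltnr] := leqP r n; last first.
  rewrite (@bin_small n r) // mul0r big1 // => k _; have := ltn_ord k => ltk.
  by rewrite (@bin_small k r) ?muln0 ?mul0r //; lia.
pose F k := 'C(n, r)%:R * (c ^+ r * (c ^+ k *+ 'C(n - r, k))).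
transitivity (\sum_(k < n.+1) (if (r <= k)%N then F (k - r)%N else 0)).
  apply: eq_bigr => k _; case: leqP => [lerk|ltkr]; last by rewrite (@bin_small k r) // muln0 mul0r.
  have -> : c ^+ k = c ^+ r * c ^+ (k - r) by rewrite -exprD subnKC.
  by rewrite bin_subset // /F -mulr_natl natrM; ring.
rewrite (sum_shift F) ?leqW // subSn // exprDn !mulr_sumr.
by apply: eq_bigr => k _; rewrite expr1n mul1r.
Qed.

(** Expanding (x+k choose k) over (x choose r) leaves the binomial sum
    [sum_bin_bin_exp] at c = -2, where 1 + c = -1. *)
Lemma horner_d_poly_reflect (R : realType) (n x : nat) :
  (d_poly R n).[- 1 - x%:R] = (-1) ^+ n * (delannoy n x)%:R.
Proof.
transitivity (\sum_(k < n.+1) \sum_(r < n.+1)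
    'C(x, r)%:R * (('C(n, k) * 'C(k, r))%:R * (-2) ^+ k) : R).
  rewrite /d_poly horner_sum; apply: eq_bigr => k _.
  rewrite !hornerM horner_exp !horner_natr (@horner_gbinom_reflect _ _ _ (x + k)); last first.
    by rewrite hornerX natrD; ring.
  have -> : 'C(x + k, k) = (\sum_(r < n.+1) 'C(k, r) * 'C(x, r))%N.
    by have := @Vandermonde_shift k x 0 n.+1 (ltn_ord k); rewrite addn0 addnC => <-.
  rewrite natr_sum !mulr_sumr mulr_suml; apply: eq_bigr => r _.
  by rewrite [(-2) ^+ k]exprNn !natrM; ring.
rewrite exchange_big /= /delannoy natr_sum mulr_sumr; apply: eq_bigr => r _.
rewrite -mulr_sumr sum_bin_bin_exp (_ : 1 + -2 = -1 :> R); last by ring.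
have -> : (-1) ^+ n = (-1) ^+ (n - r) * (-1) ^+ r :> R by rewrite -exprD subnK ?leq_ord.
by rewrite [(-2) ^+ r]exprNn !natrM natrX; ring.
Qed.

(** The sign e is kept arbitrary: natural and negative arguments use it with
    different values. *)
Lemma sum_delannoy_sun_int (R : realType) (e : int) (n m x : nat) :
  (0 < n)%N -> e = 1 \/ e = -1 ->
  (n%:R : R)^-1 * \sum_(k < n) (e%:~R ^+ k * (2 * k + 1)%:R)
    * ((delannoy k x)%:R * (sun_number k x)%:R) ^+ m \is a Num.int.
Proof.
move=> n_gt0 he.
have [z zE] := dvd_sum_legendre_span n (legendre_span_exp m (delannoy_mul_sun_span x)) he.
suff -> : \sum_(k < n) (e%:~R ^+ k * (2 * k + 1)%:R)
    * ((delannoy k x)%:R * (sun_number k x)%:R) ^+ m = n%:R * z%:~R :> R.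
  by rewrite mulKf ?pnatr_eq0 -?lt0n // intr_int.
have -> : n%:R * z%:~R = (n%:R * z)%:~R :> R by rewrite rmorphM /= rmorph_nat.
rewrite -zE rmorph_sum /=; apply: eq_bigr => k _.
by rewrite natrM !rmorphM /= !rmorphXn /= rmorphM /= !rmorph_nat.
Qed.

Theorem theorem1p3 (R : realType) (n m : nat) (eps : R)
    (n_gt0 : (0 < n)%N) (m_gt0 : (0 < m)%N) (eps_pm1 : eps = 1 \/ eps = -1) :
  integer_valued
    ((n%:R : R)^-1 *:
       \sum_(k < n) (eps ^+ k * (2 * k + 1)%:R) *:
         (d_poly R k ^+ m * s_poly R k ^+ m)).
Proof.
have [e he ->] : exists2 e : int, e = 1 \/ e = -1 & eps = e%:~R.
  by case: eps_pm1 => ->; [exists 1; [left|]|exists (-1); [right|rewrite rmorphN1]].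
move=> _ /intrP[[x|x] ->]; rewrite hornerZ horner_sum.
  rewrite -(pmulrn 1) /=.
  under eq_bigr => k _.
    rewrite hornerZ hornerM !horner_exp horner_d_poly_nat horner_s_poly_nat -exprMn.
    over.
  exact: sum_delannoy_sun_int.
have -> : (Negz x)%:~R = - 1 - x%:R :> R.
  by rewrite NegzE rmorphN /= -pmulrn -natr1 opprD addrC.
have -> : \sum_(k < n) ((e%:~R ^+ k * (2 * k + 1)%:R) *:
      (d_poly R k ^+ m * s_poly R k ^+ m)).[- 1 - x%:R]
   = \sum_(k < n) ((e * (-1) ^+ m)%:~R ^+ k * (2 * k + 1)%:R)
       * ((delannoy k x)%:R * (sun_number k x)%:R) ^+ m :> R.
  apply: eq_bigr => k _.
  rewrite hornerZ hornerM !horner_exp horner_d_poly_reflect horner_s_poly_reflect.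
  by rewrite rmorphM /= rmorphXn /= rmorphN1 !exprMn -!exprM (mulnC k m); ring.
apply: sum_delannoy_sun_int => //.
rewrite -signr_odd; case: (odd m); rewrite ?expr0 ?expr1 ?mulr1 ?mulrN1 //.
by case: he => ->; [right|left; rewrite opprK].
Qed.
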